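(* Let $n$ be a Pythagorean prime. (1) If $a,d,z$ are positive integers with $d\mid a^2$ and $(4a-1)z-n(d+a)=0$, then the solution $x=an$, $y=az/d$, $z$ of $4/n=1/x+1/y+1/z$ is of type (A). (2) If $a,d,z$ are positive integers with $d\mid a^2$ and $(4a-1)z-d-na=0$, then the solution $x=an$, $y=naz/d$, $z$ of $4/n=1/x+1/y+1/z$ is of type (B).
   Context: A Pythagorean prime is a prime of the form $n=1+4K$ with $K$ a positive integer. A solution of $4/n=1/x+1/y+1/z$ in positive integers $x,y,z$ is of type (A) if exactly one of $x,y,z$ is a multiple of $n$, and of type (B) if exactly two of $x,y,z$ are multiples of $n$. In both situations of the claim, the given $x,y,z$ are positive integers satisfying $4/n=1/x+1/y+1/z$. *)

(* Defs.v *)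
From mathcomp Require Import all_boot all_order all_algebra.

Set Implicit Arguments.
Unset Strict Implicit.
Unset Printing Implicit Defensive.

Definition pythagorean_prime (n : nat) : Prop :=
  prime n /\ exists K : nat, 0 < K /\ n = 1 + 4 * K.

Definition is_solution (n x y z : nat) : Prop :=
  [/\ 0 < x, 0 < y, 0 < z &
      (4%:R / n%:R = 1 / x%:R + 1 / y%:R + 1 / z%:R :> rat)%R].

Definition num_multiples (n x y z : nat) : nat :=
  count (fun t => n %| t) [:: x; y; z].

Definition type_A (n x y z : nat) : Prop :=
  is_solution n x y z /\ num_multiples n x y z = 1.

Definition type_B (n x y z : nat) : Prop :=
  is_solution n x y z /\ num_multiples n x y z = 2.

(* Main.v *)
(** Every prime factor of [d] divides [a], so [d] is coprime to [4a - 1]; since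
    [d] divides [a (4a - 1) z], it divides [a z].  The type is decided by
    whether [n] divides [z].  If it did, dividing the relation by [n] would
    give [(4a - 1) z' = d' + a] with [d'] a divisor of [a z'], which amounts to
    writing 4 as a sum of three unit fractions, although such a sum is at
    most 3. *)

Require Import Defs.
From mathcomp Require Import all_boot all_order all_algebra.
From mathcomp Require Import zify ring.

Import GRing.Theory Num.Theory.

(** Clearing denominators reduces the equation in [rat] to one in [nat]. *)
Lemma is_solution_nat (n x y z : nat) :
  0 < n -> 0 < x -> 0 < y -> 0 < z ->
  4 * (x * y * z) = n * (y * z + x * z + x * y) -> is_solution n x y z.
Proof.
move=> n0 x0 y0 z0 /(congr1 (fun k => k%:R : rat)%R) E; split => //.
have nz k : 0 < k -> (k%:R != 0 :> rat)%R by rewrite pnatr_eq0 lt0n.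
have := nz _ n0; have := nz _ x0; have := nz _ y0; have := nz _ z0.
move: E; rewrite !(natrM, natrD).
move: (n%:R)%R (x%:R)%R (y%:R)%R (z%:R)%R => N X Y Z E Z0 Y0 X0 N0.
(* Over this denominator the numerator is the left side of [E]. *)
have -> : (4 / N = 4 * (X * Y * Z) / (N * (X * Y * Z)) :> rat)%R.
  by field; rewrite Z0 Y0 X0 N0.
by rewrite E; field; rewrite Z0 Y0 X0 N0.
Qed.

(** Multiplying the relation by [a] gives [(4a - 1) (a z) = a m], and [d] is coprime to [4a - 1].
    Leaving [m] free covers both types and the relation divided by [n]. *)
Lemma dvdn_mul_of_relation (a d z m : nat) :
  0 < a -> d %| a ^ 2 -> 4 * a * z = z + m -> d %| a * m -> d %| a * z.
Proof.
move=> a0 da E dm.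
have cop : coprime d (4 * a - 1).
  apply: coprime_dvdl da _; apply: coprimeXl.
  rewrite coprime_sym /coprime -dvdn1.
  set g := gcdn _ _.
  have ga : g %| 4 * a by rewrite dvdn_mull // dvdn_gcdr.
  have -> : 1 = 4 * a - (4 * a - 1) by lia.
  by rewrite dvdn_sub // dvdn_gcdl.
rewrite -(Gauss_dvdr _ cop).
suff -> : (4 * a - 1) * (a * z) = a * m by [].
by rewrite mulnCA mulnBl E mul1n addKn.
Qed.

(** Each of [z], [d] and [a] is at most [a z], so the right side is at most [3 a z]. *)
Lemma four_neq_sum3_unit_fractions (a d z : nat) :
  0 < a -> 0 < z -> d %| a * z -> 4 * a * z <> z + (d + a).
Proof.
move=> a0 z0 /dvdn_leq; rewrite muln_gt0 a0 z0 => /(_ isT) le_d.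
nia.
Qed.

Lemma type_A_solution (n a d z : nat) :
  prime n -> 0 < a -> 0 < d -> 0 < z -> d %| a ^ 2 ->
  4 * a * z = z + n * (d + a) ->
  d %| a * z /\ type_A n (a * n) ((a * z) %/ d) z.
Proof.
move=> pn a0 d0 z0 da E; have n0 := prime_gt0 pn.
have dvd_aa : d %| a * (d + a) by rewrite mulnDr dvdn_add // dvdn_mull.
have daz : d %| a * z.
  by apply: dvdn_mul_of_relation E _ => //; rewrite mulnCA dvdn_mull.
split=> //; have /dvdnP [y Ey] := daz.
rewrite Ey mulnK //.
have y0 : 0 < y by nia.
split; first by apply: is_solution_nat; nia.
have nz : ~~ (n %| z).
  apply/negP => /dvdnP [z' Ez].
  have z'0 : 0 < z' by nia.
  have E' : 4 * a * z' = z' + (d + a).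
    by apply/eqP; rewrite -(eqn_pmul2l n0); apply/eqP; nia.
  (* That [d] divides [a z'] comes from the reduced relation, with [m = d + a]. *)
  by apply: four_neq_sum3_unit_fractions (dvdn_mul_of_relation _ _ _ _ _ _ E' _) E'.
have na : ~~ (n %| a).
  apply: contra nz => na.
  (* If [n] divides [a], it divides [4 a z] and [n (d + a)], hence their difference [z]. *)
  by rewrite -(dvdn_addl _ (dvdn_mulr (d + a) (dvdnn n))) -E dvdn_mulr ?dvdn_mull.
have ny : ~~ (n %| y).
  apply/negP => ny; have : n %| a * z by rewrite Ey dvdn_mulr.
  by rewrite Euclid_dvdM // (negPf na) (negPf nz).
by rewrite /num_multiples /= dvdn_mull // (negPf ny) (negPf nz).
Qed.

Lemma type_B_solution (n a d z : nat) :
  prime n -> 0 < a -> 0 < d -> 0 < z -> d %| a ^ 2 ->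
  4 * a * z = z + (d + n * a) ->
  d %| n * a * z /\ type_B n (a * n) ((n * a * z) %/ d) z.
Proof.
move=> pn a0 d0 z0 da E; have n0 := prime_gt0 pn.
have daz : d %| a * z.
  apply: dvdn_mul_of_relation E _ => //.
  by rewrite mulnDr mulnCA dvdn_add // dvdn_mull.
rewrite -mulnA; split; first by rewrite dvdn_mull.
rewrite -muln_divA //; have /dvdnP [y Ey] := daz.
rewrite Ey mulnK //.
have y0 : 0 < y by nia.
split.
  apply: is_solution_nat; rewrite ?muln_gt0 ?a0 ?n0 //.
  have F : 4 * a * z * y = z * y + a * z + n * a * y by rewrite E Ey; ring.
  have -> : 4 * (a * n * (n * y) * z) = n * n * (4 * a * z * y) by ring.
  by rewrite F; ring.
have nz : ~~ (n %| z).
  apply/negP => /dvdnP [z' Ez].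
  (* Here [d] has no factor [n] in the relation, so dividing by [n] first requires that [n] divide
     [d]. *)
  have nd : n %| d.
    have nm : n %| z + n * a by rewrite dvdn_add ?dvdn_mulr // Ez dvdn_mull.
    rewrite -(dvdn_addr _ nm).
    have -> : z + n * a + d = 4 * a * z by rewrite E; ring.
    by rewrite Ez mulnA dvdn_mull.
  have /dvdnP [d' Ed] := nd.
  have z'0 : 0 < z' by nia.
  apply: (@four_neq_sum3_unit_fractions a d' z') => //.
    (* Cancelling [n] in [d %| a * z] leaves [d' %| a * z']. *)
    by rewrite -(dvdn_pmul2r n0) -Ed -mulnA -Ez.
  apply/eqP; rewrite -(eqn_pmul2r n0); apply/eqP.
  by rewrite -mulnA -Ez E Ed Ez; ring.
by rewrite /num_multiples /= dvdn_mull // dvdn_mulr // (negPf nz).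
Qed.


(* The relations between a, d, z and n are stated in int, where subtraction is
   not truncated; the clauses [d %| _] say that the quotients y are exact. *)
Theorem mainTheorem2 (n : nat) (hn : pythagorean_prime n) :
  (forall a d z : nat, 0 < a -> 0 < d -> 0 < z -> d %| a ^ 2 ->
     ((4%:Z * a%:Z - 1) * z%:Z - n%:Z * (d%:Z + a%:Z) = 0)%R ->
     d %| a * z /\ type_A n (a * n) ((a * z) %/ d) z) /\
  (forall a d z : nat, 0 < a -> 0 < d -> 0 < z -> d %| a ^ 2 ->
     ((4%:Z * a%:Z - 1) * z%:Z - d%:Z - n%:Z * a%:Z = 0)%R ->
     d %| n * a * z /\ type_B n (a * n) ((n * a * z) %/ d) z).
Proof.
have [pn _] := hn.
split=> a d z a0 d0 z0 da E.
  by apply: type_A_solution => //; nia.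
by apply: type_B_solution => //; nia.
Qed.
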